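(* There is an integer $t_0$ such that for every integer $t \ge t_0$ and every integer $n \ge 1$, every graph on $n$ vertices with no strong $K_t$-immersion has at most $2^{t + (\log_2 t)^2}\, n$ cliques. Moreover, this bound is sharp up to a factor $2^{O(\log^2 t)}$: there is an absolute constant $A>0$ such that for every $t\ge t_0$ and every $n \ge t$ there is a graph on $n$ vertices with no strong $K_t$-immersion and with at least $2^{-A(\log_2 t)^2}\cdot 2^{t + (\log_2 t)^2}\, n$ cliques.
   Context: Graphs are finite and simple. A clique of $G$ is a set of pairwise adjacent vertices of $G$ (the empty set and single vertices count as cliques); the number of cliques is the number of such sets. A weak $H$-immersion in $G$ is a one-to-one mapping $\phi: V(H)\to V(G)$ together with a collection of edge-disjoint paths in $G$, one for each edge $uv$ of $H$, the path for $uv$ having end vertices $\phi(u)$ and $\phi(v)$. If none of the internal vertices of the paths lies in $\phi(V(H))$, it is a strong $H$-immersion. $K_t$ is the complete graph on $t$ vertices. *)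

(* Defs.v *)
From HB Require Import structures.
From mathcomp Require Import all_boot all_order all_algebra.
From mathcomp Require Import reals exp.

Set Implicit Arguments.
Unset Strict Implicit.
Unset Printing Implicit Defensive.

Import Order.TTheory GRing.Theory Num.Theory.

Record sgraph := SGraph {
  vertex :> finType;
  adj : rel vertex;
  adj_sym : symmetric adj;
  adj_irrefl : irreflexive adj
}.

Arguments adj {s} x y.

Section Graph.
Variable G : sgraph.

Definition edges : {set {set G}} :=
  [set E | [exists x : G, exists y : G, adj x y && (E == [set x; y])]].

Definition is_clique (K : {set G}) : bool :=
  [forall x in K, forall y in K, (x != y) ==> adj x y].

Definition cliques : {set {set G}} := [set K | is_clique K].

(* A path is given by the sequence of its vertices; reversing the sequence
   changes none of the three sets below. *)
Definition is_path (s : seq G) : bool :=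
  [&& s != [::], uniq s & sorted adj s].

Definition path_ends (s : seq G) : {set G} :=
  if s is x :: p then [set x; last x p] else set0.

Definition path_interior (s : seq G) : {set G} :=
  if s is x :: p then [set:: behead (belast x p)] else set0.

Definition path_edges (s : seq G) : {set {set G}} :=
  [set:: [seq [set xy.1; xy.2] | xy <- zip s (behead s)]].

End Graph.

Definition complete_rel (t : nat) : rel 'I_t := fun i j => i != j.

Fact complete_sym (t : nat) : symmetric (@complete_rel t).
Proof. by move=> i j; rewrite /complete_rel eq_sym. Qed.

Fact complete_irrefl (t : nat) : irreflexive (@complete_rel t).
Proof. by move=> i; rewrite /complete_rel eqxx. Qed.

Definition complete (t : nat) : sgraph :=
  SGraph (@complete_sym t) (@complete_irrefl t).

(* The field [route] is only constrained on the edges of [H], which are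
   unordered pairs of vertices. *)
Record weak_immersion (H G : sgraph) := WeakImmersion {
  branch : H -> G;
  route : {set H} -> seq G;
  branch_inj : injective branch;
  route_path : forall E, E \in edges H -> is_path (route E);
  route_ends : forall E, E \in edges H ->
    path_ends (route E) = [set branch u | u in E];
  route_disjoint : forall E F, E \in edges H -> F \in edges H -> E != F ->
    [disjoint path_edges (route E) & path_edges (route F)]
}.

Definition is_strong (H G : sgraph) (m : weak_immersion H G) : Prop :=
  forall E, E \in edges H ->
    [disjoint path_interior (route m E) & [set branch m u | u : H]].

Definition has_strong_immersion (H G : sgraph) : Prop :=
  exists m : weak_immersion H G, is_strong m.

Definition log2 (R : realType) (x : R) : R := (ln x / ln 2)%R.

(* Main.v *)
(* Upper bound.  Deleting a vertex v and joining its neighbours in disjoint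
   nonadjacent pairs produces a graph that immerses strongly in the original one.
   This reduction is used twice.

   Polynomial degree: if all degrees are at least 20 t^3, consider the near-twins of a
   vertex z, i.e. the vertices adjacent to almost all of N(z).  There are fewer
   than t of them (t vertices with large pairwise common neighbourhoods carry a
   strong K_t-immersion), so at some scale the set T of near-twins has a gap
   around it, and every vertex outside T has many non-neighbours in N(v), for each
   v in T.  An augmenting path argument then gives almost perfect matchings of
   non-edges in N(v) outside T, so T can be deleted without changing other
   degrees, except at a single vertex, which starts the next round.

   Logarithmic degree: on m vertices, deleting a vertex of minimum degree along a
   maximal matching of non-edges costs at most t / (m - 1) of the average degree,
   because the unmatched neighbours form a clique.  Hence the average degree is
   less than 1 + t H_(m-1).

   Dense graphs: on t + x vertices, routing missing pairs greedily through paths of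
   length two shows that some vertex has at most t + x/2 neighbours, so the number
   of cliques satisfies c(x) <= c(x - 1) + c(x/2) and is at most
   2^(t + (log x)^2 / 2 + O(log x)).

   The first two statements bound the degeneracy by O(t^3), then by O(t log t)
   inside each later neighbourhood, where the third one applies.

   Lower bound.  In K_(t-2) joined to an independent set only t - 2 vertices have
   degree at least t - 1. *)

Require Import Defs.
From mathcomp Require Import all_boot all_order all_algebra.
From mathcomp Require Import boolp reals exp.
From mathcomp Require Import zify ring lra.

Set Implicit Arguments.
Unset Strict Implicit.
Unset Printing Implicit Defensive.

Import Order.TTheory GRing.Theory Num.Theory.

(** * Strong immersions of complete graphs *)

Section Immersions.
Variables (V : finType) (t : nat).
Implicit Types (e : rel V) (b : 'I_t -> V) (c : V -> V -> {set 'I_t}).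

(** The last two conditions keep a lane away from all other branch vertices; this makes the
    immersion strong. *)
Definition lane b c e (i j : 'I_t) : rel V := fun x y =>
  [&& e x y, c x y == [set i; j],
      [forall k, (b k == x) ==> (k \in [set i; j])]
    & [forall k, (b k == y) ==> (k \in [set i; j])]].

(* The edge-disjoint paths are encoded by a colouring [c] of the edges with the
   pairs of branch vertices. *)
Definition immerses e : Prop :=
  exists b c, [/\ injective b, forall x y, c x y = c y x
    & forall i j, i != j -> connect (lane b c e i j) (b i) (b j)].

Lemma immerses_sub e e' : subrel e e' -> immerses e -> immerses e'.
Proof.
move=> sub [b [c [injb symc conn]]]; exists b, c; split=> // i j nij.
apply: connect_sub (conn i j nij) => x y /and4P[exy cxy bx by_].
by apply: connect1; apply/and4P; split=> //; apply: sub.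
Qed.

(* The vertex [v] is not removed from the type [V]; it becomes isolated. *)
Definition split_rel e (v : V) (f : V -> V) : rel V := fun x y =>
  [&& x != v, y != v & e x y || (f x == y) && (x != y)].

Lemma split_sym e v f : symmetric e -> involutive f -> symmetric (split_rel e v f).
Proof.
move=> es fK x y; rewrite /split_rel andbCA es.
by rewrite [y == x]eq_sym (can2_eq fK fK) [x == f y]eq_sym.
Qed.

Lemma split_irrefl e v f : irreflexive e -> irreflexive (split_rel e v f).
Proof. by move=> ei x; rewrite /split_rel ei eqxx andbF !andbF. Qed.

(** A new edge from [x] to [f x] is replaced by the detour through [v]. Since [f] is an involution,
    each edge at [v] serves only one such detour. *)
Lemma split_immerses e v f : 1 < t -> symmetric e -> involutive f ->
  (forall x, f x != x -> e v x && ~~ e x (f x)) ->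
  immerses (split_rel e v f) -> immerses e.
Proof.
move=> t1 es fK fe [b [c [injb symc conn]]].
(* As [1 < t], every branch vertex starts a nonempty lane, whereas [v] is isolated after the
   split. *)
have bv k : b k != v.
  have [l nkl] : exists l : 'I_t, k != l.
    have [k0|k0] := eqVneq (val k) 0.
      by exists (Ordinal t1); rewrite -val_eqE /= k0.
    by exists (Ordinal (ltnW t1)); rewrite -val_eqE.
  apply/eqP=> bkv; have /connectP[[|y p] /=] := conn k l nkl.
    by move=> _ /injb lk; rewrite lk eqxx in nkl.
  by rewrite /lane /split_rel bkv eqxx.
(* Both edges of a detour inherit the colour of the edge they replace. *)
pose c' x y := if x == v then c y (f y) else if y == v then c x (f x) else c x y.
exists b, c'; split=> //.
  move=> x y; rewrite /c'; case: (eqVneq x v) => [->|xv]; case: (eqVneq y v) => [yv|yv];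
    rewrite ?yv //.
move=> i j nij; apply: connect_sub (conn i j nij) => x y.
case/and4P=> /and3P[xv yv /orP[exy|/andP[/eqP fxy nxy]]] cxy bx by_.
  by apply: connect1; apply/and4P; split; rewrite // /c' (negPf xv) (negPf yv).
have vP : [forall k, (b k == v) ==> (k \in [set i; j])].
  by apply/forallP=> k; rewrite (negPf (bv k)).
have fyx : f y = x by rewrite -fxy fK.
have /andP[evx _] : e v x && ~~ e x (f x) by apply: fe; rewrite fxy eq_sym.
have /andP[evy _] : e v y && ~~ e y (f y) by apply: fe; rewrite fyx.
apply: (connect_trans (y := v)); apply: connect1; apply/and4P; split=> //.
- by rewrite es.
- by rewrite /c' (negPf xv) eqxx fxy.
- by rewrite /c' eqxx fyx symc.
Qed.

End Immersions.

Lemma zip_path_edges (T : eqType) (r : rel T) x p : path r x p ->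
  forall z, z \in zip (x :: p) p -> r z.1 z.2.
Proof.
elim: p x => [//|y p IH] x /= /andP[rxy rp] z; rewrite inE => /predU1P[->//|].
exact: IH.
Qed.

Lemma eq_set2_sym (T : finType) S (c : T -> T -> S) x y x' y' :
  (forall u v, c u v = c v u) -> [set x; y] = [set x'; y'] -> c x y = c x' y'.
Proof.
move=> symc eqs.
have /set2P xin : x \in [set x'; y'] by rewrite -eqs set21.
have /set2P yin : y \in [set x'; y'] by rewrite -eqs set22.
have /set2P xin' : x' \in [set x; y] by rewrite eqs set21.
have /set2P yin' : y' \in [set x; y] by rewrite eqs set22.
case: xin => ?; case: yin => ?; subst x y => //; last by case: xin' => ->.
by case: yin' => ->.
Qed.

(** Repetition-free paths are extracted from the lanes. They are edge-disjoint because an edge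
    carries one colour, and the only branch vertices they can meet are their own ends. *)
Lemma immerses_strong (G : sgraph) t : immerses t (@adj G) ->
  has_strong_immersion (complete t) G.
Proof.
case=> b [c [injb symc conn]].
pose good (E : {set 'I_t}) (s : seq G) :=
  [/\ is_path s, path_ends s = [set b u | u in E],
      forall Z, Z \in path_edges s -> exists x y, Z = [set x; y] /\ c x y = E
    & [disjoint path_interior s & [set b u | u : 'I_t]]].
have [r goodr] : {r | forall E, E \in edges (complete t) -> good E (r E)}.
  apply: cid; suff /choice[r rP] : forall E, exists s, E \in edges (complete t) -> good E s.
    by exists r.
  move=> E; have [EE|] := boolP (E \in edges (complete t)); last by exists [::].
  move: EE; rewrite inE => /existsP[i /existsP[j /andP[nij /eqP ->]]].
  have /connectP[p0 pth0 lst0] := conn i j nij.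
  case/shortenP: pth0 lst0 => p pth up _ lst.
  exists (b i :: p) => _; split.
  - rewrite /is_path up /=; apply: sub_path pth => x y; by case/and4P.
  - by rewrite /= -lst imsetU1 imset_set1.
  - move=> Z; rewrite inE => /mapP[[x y] xyin ->]; exists x, y; split=> //=.
    by have /and4P[_ /eqP] := zip_path_edges pth xyin.
  - rewrite /path_interior disjoint_subset; apply/subsetP=> z.
    rewrite !inE => zin; apply/imsetP=> -[k _ zk]; subst z.
    case: p pth up lst zin => [//|y p] pth; rewrite [uniq _]/= -[_ && uniq p]/(uniq (y :: p)).
    case/andP=> nin; rewrite {1}lastI rcons_uniq => /andP[lnin _] lst zin.
    have kij : k \in [set i; j].
      have: b k \in y :: p by rewrite lastI mem_rcons inE zin orbT.
      move: pth => /= /andP[r1 pth]; rewrite inE => /predU1P[ky|kp].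
        by have /and4P[_ _ _ /forallP/(_ k)] := r1; rewrite ky eqxx.
      move: pth; case/splitPr: kp => p1 p2; rewrite cat_path /= => /and3P[_ r2 _].
      by have /and4P[_ _ _ /forallP/(_ k)] := r2; rewrite eqxx.
    move: kij; rewrite !inE => /orP[]/eqP ekk; subst k.
      by rewrite lastI mem_rcons inE zin orbT in nin.
    by rewrite /= in lst; rewrite -lst zin in lnin.
have disj E F : E \in edges (complete t) -> F \in edges (complete t) -> E != F ->
    [disjoint path_edges (r E) & path_edges (r F)].
  move=> EE FF nEF; have [_ _ h1 _] := goodr E EE; have [_ _ h2 _] := goodr F FF.
  rewrite disjoint_subset; apply/subsetP=> Z ZE; apply/negP=> ZF.
  have [x [y [Zxy cE]]] := h1 Z ZE; have [x' [y' [Zxy' cF]]] := h2 Z ZF.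
  by case/eqP: nEF; rewrite -cE -cF; apply: eq_set2_sym => //; rewrite -Zxy.
exists (@WeakImmersion (complete t) G b r injb
  (fun E EE => let: And4 h _ _ _ := goodr E EE in h)
  (fun E EE => let: And4 _ h _ _ := goodr E EE in h) disj).
by move=> E EE /=; have [_ _ _] := goodr E EE.
Qed.

Lemma subset_of_card (T : finType) (A : {set T}) n : n <= #|A| ->
  exists2 B : {set T}, B \subset A & #|B| = n.
Proof.
case/card_geqP=> s [us <- sA]; exists [set:: s]; last by rewrite cardsE (card_uniqP us).
by apply/subsetP=> x; rewrite inE => /sA.
Qed.

(** The element [a] is coloured last: its coloured conflicts block fewer colours than its list [L a]
    contains. *)
Lemma greedy_coloring (T V : finType) (v0 : V) (conf : rel T) (L : T -> {set V})
    (A : {set T}) : symmetric conf ->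
  (forall x, x \in A -> #|[set y in A | (y != x) && conf x y]| < #|L x|) ->
  exists m : T -> V, (forall x, x \in A -> m x \in L x) /\
    {in A &, forall x y, x != y -> conf x y -> m x != m y}.
Proof.
move=> confs; have [n] := ubnP #|A|; elim: n => // n IH in A *; rewrite ltnS => cA hL.
have [->|[a aA]] := set_0Vmem A.
  by exists (fun=> v0); split=> [x|x y]; rewrite inE.
have [||m [mL mC]] := IH (A :\ a).
- by rewrite (cardsD1 a) aA in cA.
- move=> x /setD1P[_ xA]; apply: leq_ltn_trans (hL x xA); apply: subset_leq_card.
  by apply/subsetP=> y; rewrite !inE => /andP[/andP[_ ->] ->].
pose N := [set y in A | (y != a) && conf a y].
have [w] : exists w, w \in L a :\: (m @: N).
  apply/card_gt0P; rewrite cardsD subn_gt0; apply: leq_ltn_trans (hL a aA).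
  by apply: leq_trans (leq_imset_card m _); apply: subset_leq_card; apply: subsetIr.
case/setDP=> wL wN; exists (fun x => if x == a then w else m x); split=> [x xA|x y xA yA nxy cxy].
  by case: eqVneq => [->//|nxa]; apply: mL; rewrite !inE nxa.
have wm z : z \in A -> z != a -> conf a z -> w != m z.
  move=> zA nza caz; apply: contraNneq wN => ->; apply/imsetP; exists z => //.
  by rewrite inE zA nza.
case: (eqVneq x a) => [xa|nxa]; case: (eqVneq y a) => [ya|nya].
- by rewrite xa ya eqxx in nxy.
- by apply: wm => //; rewrite -xa.
- by rewrite eq_sym; apply: wm => //; rewrite -ya confs.
- by apply: mC; rewrite ?inE ?nxa ?nya.
Qed.

Definition nbrs (V : finType) (e : rel V) (x : V) : {set V} := [set y | e x y].

Definition non_nbrs (V : finType) (e : rel V) (B : {set V}) (x : V) : {set V} :=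
  [set y in B | (y != x) && ~~ e x y].

(** Each non-adjacent pair of [B] is routed through a common neighbour outside [B], and two pairs
    need distinct middles only if they share a vertex. The pair of [x] and [y] meets at most
    [#|non_nbrs e B x| + #|non_nbrs e B y| - 2] others, whence the [+ 1]. *)
Lemma greedy_immerses (V : finType) (e : rel V) t (B : {set V}) :
  0 < t -> symmetric e -> #|B| = t ->
  {in B &, forall x y, x != y -> ~~ e x y ->
     #|non_nbrs e B x| + #|non_nbrs e B y| <= #|(nbrs e x :&: nbrs e y) :\: B| + 1} ->
  immerses t e.
Proof.
move=> t0 es cB hB.
pose pairP E x y := [&& x \in B, y \in B, x != y, ~~ e x y & E == [set x; y]].
pose A : {set {set V}} := [set E | [exists x, exists y, pairP E x y]].
have AP E : reflect (exists x y, pairP E x y) (E \in A).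
  rewrite inE; apply: (iffP existsP) => [[x /existsP[y h]]|[x [y h]]].
    by exists x, y.
  by exists x; apply/existsP; exists y.
pose conf (E F : {set V}) := ~~ [disjoint E & F].
pose L (E : {set V}) := [set w | (w \notin B) && [forall x in E, e x w]].
have Lpair x y : L [set x; y] = (nbrs e x :&: nbrs e y) :\: B.
  apply/setP=> w; rewrite !inE; congr (_ && _).
  apply/forallP/andP => [h|[h1 h2] z].
    by move: (h x) (h y); rewrite set21 set22.
  by apply/implyP=> /set2P[]->.
have [v0 _] : exists v, v \in B by apply/card_gt0P; rewrite cB.
have [||m [mL mC]] := @greedy_coloring _ V v0 conf L A.
- by move=> E F; rewrite /conf disjoint_sym.
- move=> E /AP[x [y /and5P[xB yB nxy nexy /eqP->]]]; rewrite Lpair.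
  have yx : y \in non_nbrs e B x by rewrite inE yB eq_sym nxy.
  have xy : x \in non_nbrs e B y by rewrite inE xB nxy es.
  have: #|[set F in A | (F != [set x; y]) && conf [set x; y] F]| <=
        #|non_nbrs e B x :\ y| + #|non_nbrs e B y :\ x|.
    apply: leq_trans (leq_add (leq_imset_card (fun z => [set x; z]) _)
      (leq_imset_card (fun z => [set y; z]) _)).
    apply: leq_trans (leq_card_setU _ _); apply: subset_leq_card.
    apply/subsetP=> F /setIdP[/AP[x' [y' /and5P[x'B y'B nxy' nexy' /eqP->]]] /andP[nF]].
    move=> /pred0Pn[z /=]; rewrite !inE => /andP[zxy zxy']; apply/orP.
    have [u [nzu uB nezu Fzu]] : exists u, [/\ u != z, u \in B, ~~ e z u & [set x'; y'] = [set z; u]].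
      case/orP: zxy' => /eqP->; first by exists y'; rewrite eq_sym.
      by exists x'; rewrite es setUC.
    have nuB : u \in non_nbrs e B z by rewrite inE uB nzu.
    case/orP: zxy (nuB) => /eqP zE; rewrite Fzu zE => nu.
      left; apply/imsetP; exists u => //; rewrite !inE; move: nu; rewrite inE => ->.
      by rewrite andbT; apply: contraNneq nF => uy; rewrite Fzu zE uy.
    right; apply/imsetP; exists u => //; rewrite !inE; move: nu; rewrite inE => ->.
    by rewrite andbT; apply: contraNneq nF => uy; rewrite Fzu zE uy setUC.
  have := hB x y xB yB nxy nexy; rewrite (cardsD1 y (non_nbrs e B x)) yx.
  rewrite (cardsD1 x (non_nbrs e B y)) xy /= => h1 h2.
  by apply: leq_ltn_trans h2 _; lia.
pose P x y E := [&& E \in A, x \in E & m E == y].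
pose col x y : {set V} := if x \in B then
    (if y \in B then [set x; y] else odflt set0 [pick E | P x y E])
  else if y \in B then odflt set0 [pick E | P y x E] else set0.
pose b (i : 'I_t) := enum_val (cast_ord (esym cB) i).
have bB i : b i \in B by apply: enum_valP.
have binj : injective b by move=> i j /enum_val_inj /cast_ord_inj.
pose c x y := [set k | b k \in col x y].
have cE i j x y : col x y = [set b i; b j] -> c x y == [set i; j].
  by move=> colE; apply/eqP/setP=> k; rewrite !inE colE !inE !(inj_eq binj).
have colm x y E : E \in A -> x \in E -> m E = y -> col x y = E /\ col y x = E.
  move=> EA xE mE.
  have xB : x \in B by case/AP: EA xE => u [w /and5P[uB wB _ _ /eqP->]] /set2P[]->.
  have yB : y \notin B by have := mL E EA; rewrite mE inE => /andP[].
  have -> : col y x = col x y by rewrite /col xB (negPf yB).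
  suff -> : col x y = E by [].
  rewrite /col xB (negPf yB); case: pickP => [F /and3P[FA xF /eqP mF] /=|/(_ E)]; last first.
    by rewrite /P EA xE mE eqxx.
  apply/eqP/negPn/negP=> nFE.
  have cFE : conf F E by apply/pred0Pn; exists x; rewrite /= xF xE.
  by have := mC F E FA EA nFE cFE; rewrite mF mE eqxx.
exists b, c; split=> // [x y|i j nij].
  by rewrite /c /col; case: (x \in B); case: (y \in B); rewrite // setUC.
have av k : (k \in [set i; j]) -> [forall l, (b l == b k) ==> (l \in [set i; j])].
  by move=> kij; apply/forallP=> l; rewrite (inj_eq binj); apply/implyP=> /eqP->.
have avN w : w \notin B -> [forall l, (b l == w) ==> (l \in [set i; j])].
  by move=> wB; apply/forallP=> l; apply/implyP=> /eqP blw; rewrite -blw bB in wB.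
have [eij|neij] := boolP (e (b i) (b j)).
  apply: connect1; apply/and4P; split; rewrite ?av ?set21 ?set22 //.
  by apply: cE; rewrite /col !bB.
pose E := [set b i; b j].
have EA : E \in A.
  by apply/AP; exists (b i), (b j); rewrite /pairP !bB (inj_eq binj) nij neij eqxx.
have := mL E EA; rewrite Lpair !inE => /and3P[mB eim ejm].
have [c1 c2] := colm (b i) (m E) E EA (set21 _ _) erefl.
have [c3 c4] := colm (b j) (m E) E EA (set22 _ _) erefl.
apply: (connect_trans (y := m E)); apply: connect1; apply/and4P; split=> //;
  rewrite ?av ?avN ?set21 ?set22 //; try exact: cE.
by rewrite es.
Qed.

Section Corollaries.
Variables (V : finType) (e : rel V) (t : nat).
Hypotheses (t_gt0 : 0 < t) (e_sym : symmetric e) (e_irrefl : irreflexive e).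

Lemma clique_immerses (K : {set V}) : t <= #|K| ->
  {in K &, forall x y, x != y -> e x y} -> immerses t e.
Proof.
move=> /subset_of_card[B BK cB] clK; apply: (greedy_immerses t_gt0 e_sym cB).
by move=> x y xB yB nxy /negP[]; apply: clK; rewrite ?(subsetP BK).
Qed.

Lemma non_nbrs_le (B : {set V}) x : x \in B -> #|non_nbrs e B x| < #|B|.
Proof.
move=> xB; rewrite (cardsD1 x B) xB ltnS; apply: subset_leq_card.
by apply/subsetP=> y; rewrite !inE => /and3P[-> -> _].
Qed.

(** For [t] branch vertices, at least [2 * t] of the common neighbours lie outside the branch set,
    and each branch vertex has fewer than [t] non-neighbours inside it. *)
Lemma common_nbrs_immerses (B : {set V}) : t <= #|B| ->
  {in B &, forall x y, x != y -> 3 * t <= #|nbrs e x :&: nbrs e y|} -> immerses t e.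
Proof.
move=> /subset_of_card[C CB cC] hB; apply: (greedy_immerses t_gt0 e_sym cC).
move=> x y xC yC nxy _; have := hB x y (subsetP CB x xC) (subsetP CB y yC) nxy.
have := subset_leq_card (subsetIr (nbrs e x :&: nbrs e y) C).
by have := non_nbrs_le xC; have := non_nbrs_le yC; rewrite cardsD; lia.
Qed.

(** Otherwise every vertex of [W] has fewer than [x / 2] non-neighbours in [W] besides itself. Any
    [t] vertices then serve as branch vertices, and the other [x] vertices supply enough middles for
    the greedy routing. *)
Lemma dense_immerses (W : {set V}) x : #|W| = t + x -> 0 < x -> ~ immerses t e ->
  exists2 v, v \in W & #|W :&: nbrs e v| <= t + x./2.
Proof.
move=> cW x0 nimm; apply/exists_inP; apply: contraPT nimm; rewrite negb_exists_in.
move=> /forall_inP hW; apply.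
have [B BW cB] : exists2 B : {set V}, B \subset W & #|B| = t.
  by apply: subset_of_card; rewrite cW leq_addr.
have cWB : #|W :\: B| = x by rewrite cardsDS // cW cB addKn.
(* The [.+2] collects the strict inequality and [v], which is not its own neighbour. *)
have few v : v \in B -> #|non_nbrs e B v| + #|W :\: B :\: nbrs e v| + (x./2).+2 <= x.
  move=> vB; have := hW v (subsetP BW v vB); rewrite -ltnNge.
  have -> : non_nbrs e B v = (B :\ v) :\: nbrs e v.
    by apply/setP=> y; rewrite !inE; case: (y \in B); case: (y == v); case: (e v y).
  have := cardsID (nbrs e v) (B :\ v); have := cardsID (nbrs e v) (W :\: B).
  have -> : (B :\ v) :&: nbrs e v = W :&: nbrs e v :&: B.
    apply/setP=> y; rewrite !inE; case: eqVneq => [->|_]; first by rewrite e_irrefl !andbF.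
    case yB : (y \in B); last by rewrite !andbF.
    by rewrite (subsetP BW y yB) /= andbT.
  have -> : (W :\: B) :&: nbrs e v = W :&: nbrs e v :\: B by rewrite setIDAC.
  have := cardsID B (W :&: nbrs e v); have := cardsD1 v B; rewrite vB; lia.
apply: (greedy_immerses t_gt0 e_sym cB) => u v uB vB _ _.
have : #|W :\: B| <= #|(nbrs e u :&: nbrs e v) :\: B| +
    (#|W :\: B :\: nbrs e u| + #|W :\: B :\: nbrs e v|).
  apply: (leq_trans _ (leq_add (leqnn _) (leq_card_setU _ _))).
  apply: (leq_trans _ (leq_card_setU _ _)).
  apply: subset_leq_card; apply/subsetP=> y; rewrite !inE => /andP[-> ->].
  by case: (e u y); case: (e v y).
by have := few u uB; have := few v vB; lia.
Qed.

End Corollaries.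

(** * Matchings of the complement *)

Section Matchings.
Variables (V : finType) (e : rel V) (Y : {set V}).
Hypothesis e_sym : symmetric e.
Implicit Types (f : V -> V) (u w a b : V).

(* A matching of the complement graph on [Y] is an involution whose fixed points
   are the unmatched vertices. *)
Definition comatching f : Prop :=
  involutive f /\ forall x, f x != x -> x \in Y /\ ~~ e x (f x).

Definition unmatched f : {set V} := [set x in Y | f x == x].

Definition link f u w : V -> V :=
  fun x => if x == u then w else if x == w then u else f x.

Definition unlink f a : V -> V :=
  fun x => if (x == a) || (x == f a) then x else f x.

Lemma comatching_link f u w : comatching f -> u \in unmatched f ->
  w \in unmatched f -> u != w -> ~~ e u w ->
  comatching (link f u w) /\ unmatched (link f u w) = unmatched f :\ u :\ w.
Proof.
rewrite !inE => -[fK fe] /andP[uY /eqP fu] /andP[wY /eqP fw] nuw neuw.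
split; [split|].
- move=> x; rewrite /link; have [->|nxu] := eqVneq x u; first by rewrite eqxx eq_sym (negPf nuw).
  have [->|nxw] := eqVneq x w; first by rewrite eqxx.
  have -> : (f x == u) = false by rewrite -[in X in _ == X]fu (can_eq fK) (negPf nxu).
  have -> : (f x == w) = false by rewrite -[in X in _ == X]fw (can_eq fK) (negPf nxw).
  by rewrite fK.
- move=> x; rewrite /link; have [->|nxu] := eqVneq x u; first by split.
  have [->|nxw] := eqVneq x w; first by rewrite e_sym.
  exact: fe.
- apply/setP=> x; rewrite !inE /link; have [->|nxu] := eqVneq x u.
    by rewrite eq_sym (negPf nuw) !andbF.
  by have [->|nxw] := eqVneq x w; rewrite ?(negPf nuw) ?andbF.
Qed.

Lemma card_link f u w : u \in unmatched f -> w \in unmatched f -> u != w ->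
  (#|unmatched f :\ u :\ w| + 2 = #|unmatched f|)%N.
Proof.
move=> uf wf nuw; rewrite (cardsD1 u (unmatched f)) uf (cardsD1 w (_ :\ u)).
by rewrite in_setD1 wf eq_sym nuw; lia.
Qed.

Lemma comatching_unlink f a : comatching f -> f a != a ->
  comatching (unlink f a) /\ unmatched (unlink f a) = a |: (f a |: unmatched f).
Proof.
move=> [fK fe] nfa; have [aY _] := fe a nfa.
have [faY _] : f a \in Y /\ ~~ e (f a) (f (f a)) by apply: fe; rewrite fK eq_sym.
split; [split|].
- move=> x; rewrite /unlink; case E : ((x == a) || (x == f a)); first by rewrite E.
  have /norP[n1 n2] := negbT E.
  have -> : (f x == a) = false by rewrite -[in X in _ == X](fK a) (can_eq fK) (negPf n2).
  by rewrite (can_eq fK) (negPf n1) fK.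
- by move=> x; rewrite /unlink; case: ifP => [_|_ /fe//]; rewrite eqxx.
- apply/setP=> x; rewrite !inE /unlink; have [->|nxa] := eqVneq x a; first by rewrite aY eqxx.
  by have [->|nxfa] := eqVneq x (f a); rewrite ?faY ?eqxx.
Qed.

Lemma card_unlink f a : comatching f -> f a != a ->
  #|a |: (f a |: unmatched f)| = (#|unmatched f| + 2)%N.
Proof.
move=> [fK _] nfa; rewrite !cardsU1 !inE fK [a == f a]eq_sym (negPf nfa) /=.
by rewrite andbF andbF; lia.
Qed.

Lemma comatching_id : comatching id.
Proof. by split=> // x; rewrite eqxx. Qed.

(** The empty matching [id] is augmented repeatedly. Each augmentation covers two more vertices, so
    the parity of the unmatched set is invariant. *)
Lemma comatching_reduce (good : {set V} -> Prop) :
  (forall f, comatching f -> good (unmatched f) \/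
     exists2 f', comatching f' & (#|unmatched f'| + 2 = #|unmatched f|)%N) ->
  exists f, [/\ comatching f, good (unmatched f) & odd #|unmatched f| = odd #|Y|].
Proof.
move=> step; suff: forall f, comatching f -> odd #|unmatched f| = odd #|Y| ->
    exists f', [/\ comatching f', good (unmatched f') & odd #|unmatched f'| = odd #|Y|].
  by apply; [exact: comatching_id|congr (odd #|pred_of_set _|); apply/setP=> x; rewrite inE eqxx andbT].
move=> f; have [n] := ubnP #|unmatched f|; elim: n f => // n IH f ltn fm odf.
have [gf|[f' f'm cf']] := step f fm; first by exists f.
by apply: (IH f') => //; [lia|rewrite -odf -cf' oddD addbF].
Qed.

Lemma comatching_maximal : exists f, [/\ comatching f,
  {in unmatched f &, forall x y, x != y -> e x y} & odd #|unmatched f| = odd #|Y|].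
Proof.
apply: (@comatching_reduce (fun U => {in U &, forall x y, x != y -> e x y})) => f fm.
have [h|] := pselect {in unmatched f &, forall x y, x != y -> e x y}; first by left.
move=> nh; right; apply: contrapT => nex; apply: nh => u w uU wU nuw.
apply/negPn/negP => neuw; apply: nex; have [h1 h2] := comatching_link fm uU wU nuw neuw.
by exists (link f u w); rewrite // h2 card_link.
Qed.

(** The augmenting path is [u], [f a], [a], [b], [f b], [u']. Its matched edges are unlinked first,
    then the others are linked. *)
Lemma comatching_augment f u u' a b : comatching f ->
  u \in unmatched f -> u' \in unmatched f -> u != u' ->
  f a != a -> f b != b -> a != b ->
  ~~ e u (f a) -> ~~ e u' (f b) -> ~~ e a b ->
  exists2 f', comatching f' & (#|unmatched f'| + 2 = #|unmatched f|)%N.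
Proof.
move=> fm uU u'U nuu' nfa nfb nab eua eub eab; have [fK fe] := fm.
have unm x y : x \in unmatched f -> f y != y -> (x == y = false) * (x == f y = false).
  rewrite inE => /andP[_ /eqP fx] nfy; split; apply/eqP=> xy.
    by rewrite -xy fx eqxx in nfy.
  by move: fx nfy; rewrite xy fK => <-; rewrite eqxx.
have [f1m U1] := comatching_unlink fm nfa; have c1 := card_unlink fm nfa; rewrite -U1 in c1.
have in1 x : x \in unmatched f -> x \in unmatched (unlink f a).
  by move=> xU; rewrite U1 !in_setU1 xU !orbT.
have a1 : a \in unmatched (unlink f a) by rewrite U1 setU11.
have fa1 : f a \in unmatched (unlink f a) by rewrite U1 !in_setU1 eqxx orbT.
have nufa : u != f a by rewrite (unm _ _ uU nfa).
have nu'a : u' != a by rewrite (unm _ _ u'U nfa).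
(* If [a] and [b] are partners, the path shrinks to [u], [f a], [a], [u']. *)
have [bfa|nbfa] := eqVneq b (f a).
  have [f2m U2] := comatching_link f1m (in1 _ uU) fa1 nufa eua.
  have c2 := card_link (in1 _ uU) fa1 nufa; rewrite -U2 in c2.
  have u'2 : u' \in unmatched (link (unlink f a) u (f a)).
    by rewrite U2 !in_setD1 in1 // [u' == u]eq_sym nuu' (unm _ _ u'U nfa).
  have a2 : a \in unmatched (link (unlink f a) u (f a)).
    by rewrite U2 !in_setD1 a1 [a == f a]eq_sym nfa [a == u]eq_sym (unm _ _ uU nfa).
  have eu'a : ~~ e u' a by rewrite bfa fK in eub.
  have [f3m U3] := comatching_link f2m u'2 a2 nu'a eu'a.
  have c3 := card_link u'2 a2 nu'a; rewrite -U3 in c3.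
  by exists (link (link (unlink f a) u (f a)) u' a) => //; apply: (@addIn 2); rewrite c3 c2.
set f1 := unlink f a in f1m U1 c1 in1 a1 fa1.
have f1b : f1 b = f b by rewrite /f1 /unlink eq_sym (negPf nab) (negPf nbfa).
have nf1b : f1 b != b by rewrite f1b.
have [f2m U2] := comatching_unlink f1m nf1b; have c2 := card_unlink f1m nf1b.
rewrite -U2 in c2; rewrite f1b in U2; set f2 := unlink f1 b in f2m U2 c2.
have in2 x : x \in unmatched f1 -> x \in unmatched f2.
  by move=> xU; rewrite U2 !in_setU1 xU !orbT.
have b2 : b \in unmatched f2 by rewrite U2 setU11.
have fb2 : f b \in unmatched f2 by rewrite U2 !in_setU1 eqxx orbT.
have nafb : a != f b by apply: contraNneq nbfa => ->; rewrite fK.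
have nfab : f a != f b by rewrite (can_eq fK).
have [f3m U3] := comatching_link f2m (in2 _ (in1 _ uU)) (in2 _ fa1) nufa eua.
have c3 := card_link (in2 _ (in1 _ uU)) (in2 _ fa1) nufa; rewrite -U3 in c3.
set f3 := link f2 u (f a) in f3m U3 c3.
have a3 : a \in unmatched f3.
  by rewrite U3 !in_setD1 in2 // [a == f a]eq_sym nfa [a == u]eq_sym (unm _ _ uU nfa).
have b3 : b \in unmatched f3.
  by rewrite U3 !in_setD1 b2 nbfa [b == u]eq_sym (unm _ _ uU nfb).
have [f4m U4] := comatching_link f3m a3 b3 nab eab.
have c4 := card_link a3 b3 nab; rewrite -U4 in c4.
set f4 := link f3 a b in f4m U4 c4.
have u'4 : u' \in unmatched f4.
  rewrite U4 U3 !in_setD1 (in2 _ (in1 _ u'U)) [u' == u]eq_sym nuu'.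
  by rewrite !(unm _ _ u'U nfa) (unm _ _ u'U nfb).
have fb4 : f b \in unmatched f4.
  rewrite U4 U3 !in_setD1 fb2 nfb [f b == a]eq_sym nafb [f b == f a]eq_sym nfab.
  by rewrite [f b == u]eq_sym (unm _ _ uU nfb).
have nu'fb : u' != f b by rewrite (unm _ _ u'U nfb).
have [f5m U5] := comatching_link f4m u'4 fb4 nu'fb eub.
have c5 := card_link u'4 fb4 nu'fb; rewrite -U5 in c5.
exists (link f4 u' (f b)) => //; do 2 apply: (@addIn 2).
by rewrite c5 c4 c3 c2 c1.
Qed.

(* Two unmatched vertices [u] and [u'] are joined by an augmenting path of length 3
   or 5, unless the partners of the non-neighbours of [u] are completely joined to
   those of [u'], which gives a K_(t,3t). *)
Lemma comatching_near_perfect t : 0 < t -> irreflexive e -> ~ immerses t e ->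
  (forall y, y \in Y -> 4 * t <= #|non_nbrs e Y y|) ->
  exists f, [/\ comatching f, #|unmatched f| <= 1 & odd #|unmatched f| = odd #|Y|].
Proof.
move=> t0 ei nimm degY.
apply: (@comatching_reduce (fun U => #|U| <= 1)) => f fm.
have [le1|/card_gt1P gt1] := leqP #|unmatched f| 1; [by left|right].
case: gt1 => u [u' [uU u'U nuu']].
apply: contrapT => nex.
have [fK fe] := fm.
have uY x : x \in unmatched f -> x \in Y by rewrite inE => /andP[].
have nonU x y : x \in unmatched f -> y \in non_nbrs e Y x -> f y != y.
  move=> xU; rewrite inE => /and3P[yY nyx nexy]; apply/negP=> fy; apply: nex.
  have yU : y \in unmatched f by rewrite inE yY.
  rewrite eq_sym in nyx.
  have [h1 h2] := comatching_link fm xU yU nyx nexy.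
  by exists (link f x y); rewrite // h2 card_link.
pose G x := f @: non_nbrs e Y x.
have GP x a : x \in unmatched f -> a \in G x -> f a != a /\ ~~ e x (f a).
  move=> xU /imsetP[y yN ->]; rewrite fK eq_sym (nonU x) //.
  by move: yN; rewrite inE => /and3P[].
have cG x : x \in unmatched f -> 4 * t <= #|G x|.
  by move=> xU; rewrite card_imset; [apply/degY/uY|apply: can_inj fK].
have adjG a b : a \in G u -> b \in G u' -> a != b -> e a b.
  move=> aG bG nab; apply/negPn/negP=> neab; apply: nex.
  have [nfa eua] := GP u a uU aG; have [nfb eub] := GP u' b u'U bG.
  exact: (comatching_augment fm uU u'U nuu' nfa nfb nab).
(* The sets [G u] and [G u'] may overlap; discarding [A] from [G u'] still leaves [3 * t] common
   neighbours. *)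
have [A AG cA] : exists2 A : {set V}, A \subset G u & #|A| = t.
  by apply: subset_of_card; apply: leq_trans (cG u uU); lia.
apply: nimm; apply: (@common_nbrs_immerses _ e t t0 e_sym A); first by rewrite cA.
move=> x y xA yA nxy; apply: (@leq_trans #|G u' :\: A|).
  have := cG u' u'U; have := cardsID A (G u'); have := subset_leq_card (subsetIr (G u') A).
  lia.
apply: subset_leq_card; apply/subsetP=> z; rewrite !inE => /andP[zA zG].
by rewrite !adjG ?(subsetP AG) //; apply: contraNneq zA => <-.
Qed.

End Matchings.

(** * A polynomial degree forces an immersion *)

(** The neighbour [v] is traded for the new neighbour [f x], so a matched neighbour of [v] keeps its
    degree. *)
Lemma card_nbrs_split (V : finType) (e : rel V) v f x :
  irreflexive e -> involutive f ->
  (forall y, f y != y -> e v y && ~~ e y (f y)) -> x != v -> symmetric e ->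
  #|nbrs (split_rel e v f) x| + e v x = #|nbrs e x| + (f x != x).
Proof.
move=> ei fK fe nxv es.
have -> : nbrs (split_rel e v f) x =
    (nbrs e x :\ v) :|: (if f x != x then [set f x] else set0).
  apply/setP=> y; rewrite !inE /split_rel nxv /=.
  have [fx|nfx] := eqVneq (f x) x; first by rewrite fx inE andbN !orbF.
  rewrite inE; have [yfx|nyfx] := eqVneq y (f x); last by rewrite /= !orbF.
  rewrite yfx [x == f x]eq_sym nfx /= !orbT andbT; apply/eqP=> fxv.
  have /fe/andP[] : f (f x) != f x by rewrite fK eq_sym.
  by rewrite -fxv ei.
have evx : (v \in nbrs e x) = e v x by rewrite inE es.
rewrite (cardsD1 v (nbrs e x)) evx -[RHS]addnA addnC; congr addn.
have [fx|nfx] := eqVneq (f x) x; first by rewrite setU0 addn0.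
rewrite setUC cardsU1 addnC; congr addn; rewrite !inE.
by have /andP[_ /negPf->] := fe x nfx; rewrite andbF.
Qed.

(* [X] is the set of vertices deleted so far; [z] absorbs the parity defects. *)
Lemma cluster_deletion (V : finType) (e : rel V) t (T : {set V}) z :
  1 < t -> symmetric e -> irreflexive e -> ~ immerses t e -> #|T| <= t ->
  z \notin T -> {in T, forall v, e v z} ->
  (forall v w, v \in T -> w \notin T -> 7 * t <= #|nbrs e v :\: nbrs e w|) ->
  forall X : {set V}, X \subset T -> exists e' : rel V,
    [/\ [/\ symmetric e', irreflexive e' & ~ immerses t e'],
        forall x y, x \in X -> ~~ e' x y,
        forall x y, x \in T :\: X -> y \notin X -> e' x y = e x y,
        forall w, w \notin T -> #|nbrs e' w :\: nbrs e w| <= #|X|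
      & (forall w, w \notin T -> w != z -> #|nbrs e' w| = #|nbrs e w|) /\
        #|nbrs e z| <= #|nbrs e' z| + #|X|].
Proof.
move=> t1 es ei nimm cT zT ez gap X; have [n] := ubnP #|X|.
elim: n X => // n IH X ltn XT; have [->|[v vX]] := set_0Vmem X.
  exists e; split=> [//|x y|//|w _|]; rewrite ?inE //; first by rewrite setDv.
  by split=> //; apply: leq_addr.
have vT := subsetP XT v vX.
have cX := cardsD1 v X; rewrite vX /= in cX.
have X'T : X :\ v \subset T by apply: subset_trans XT; apply: subD1set.
have [|e' [[es' ei' nimm'] isol keep new [degs degz]]] := IH (X :\ v) _ X'T; first by lia.
have keepv y : y \notin T -> e' v y = e v y.
  move=> yT; rewrite keep // ?inE ?eqxx ?vT //.
  by rewrite negb_and negbK (contraNN (subsetP XT y) yT) orbT.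
pose Y0 := nbrs e' v :\: T.
have zY0 : z \in Y0 by rewrite !inE zT keepv // ez.
(* Dropping [z] when necessary makes the size even, so that a matching missing at most one vertex is
   perfect. *)
pose Y := if odd #|Y0| then Y0 :\ z else Y0.
have YY0 y : y \in Y -> y \in Y0 by rewrite /Y; case: ifP => // _ /setD1P[].
have Y0Y y : y \in Y0 -> y != z -> y \in Y.
  by move=> yY0 nyz; rewrite /Y; case: ifP => // _; rewrite in_setD1 nyz.
have Yv y : y \in Y -> e' v y by move/YY0; rewrite !inE => /andP[].
have YT y : y \in Y -> y \notin T by move/YY0; rewrite !inE => /andP[].
have evenY : odd #|Y| = false.
  rewrite /Y; case: ifP => // oddY0; move: oddY0.
  by rewrite (cardsD1 z Y0) zY0 /=; case: odd.
have degY y : y \in Y -> 4 * t <= #|non_nbrs e' Y y|.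
  move=> yY; have yT := YT y yY.
  (* Of the gap [7 * t], at most [t] is lost to [T], 2 to [z] and [y], and [t] to edges added at [y]
     by earlier deletions; [4 * t] remains. *)
  have cover : nbrs e v :\: nbrs e y \subset
      non_nbrs e' Y y :|: (T :|: [set z; y] :|: (nbrs e' y :\: nbrs e y)).
    apply/subsetP=> u; rewrite in_setD !in_setU !in_set1 => /andP[neyu evu].
    have [//|uT] := boolP (u \in T); first by rewrite orbT.
    have [//|nuz] := eqVneq u z; first by rewrite !orbT.
    have [//|nuy] := eqVneq u y; first by rewrite !orbT.
    rewrite in_setD neyu /= !inE /= nuy /=.
    have -> : u \in Y.
      by apply: Y0Y => //; rewrite !inE uT keepv //; move: evu; rewrite inE.
    by case: (e' y u); rewrite ?orbT.
  have h1 := leq_trans (gap v y vT yT) (subset_leq_card cover).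
  have h2 := (leq_card_setU (non_nbrs e' Y y)
    (T :|: [set z; y] :|: (nbrs e' y :\: nbrs e y))).1.
  have h3 := (leq_card_setU (T :|: [set z; y]) (nbrs e' y :\: nbrs e y)).1.
  have h4 := (leq_card_setU T [set z; y]).1; have h5 := new y yT.
  have h6 := subset_leq_card X'T.
  have h7 : #|[set z; y]| <= 2 by rewrite cards2; case: (z != y).
  move: h1 h2 h3 h4 h5 h6 h7 cT t1; clear; lia.
have [f [[fK fe] unf oddf]] := comatching_near_perfect es' (ltnW t1) ei' nimm' degY.
have fY y : y \in Y -> f y != y.
  have un0 : #|unmatched Y f| = 0 by move: unf oddf; rewrite evenY; case: #|_| => [|[]].
  move/cards0_eq: un0 => un0 yY; apply/negP=> fy.
  have : y \in unmatched Y f by rewrite inE yY.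
  by rewrite un0 inE.
have fe' y : f y != y -> e' v y && ~~ e' y (f y) by case/fe=> /Yv -> ->.
have fT x : x \in T -> f x = x.
  by move=> xT; apply/eqP/negPn/negP=> /fe[/YT]; rewrite xT.
have deg x : x != v ->  #|nbrs (split_rel e' v f) x| + e' v x = #|nbrs e' x| + (f x != x).
  by move=> nxv; apply: card_nbrs_split.
have nTv x : x \notin T -> x != v by apply: contraNneq => ->.
exists (split_rel e' v f); split.
- split; [exact: split_sym|exact: split_irrefl|].
  by move=> /(split_immerses t1 es' fK fe').
- move=> x y xX; rewrite /split_rel; have [//|nxv] := eqVneq x v.
  rewrite fT ?(subsetP XT) //= andbN orbF negb_and isol ?orbT //.
  by rewrite !inE nxv.
- move=> x y /setDP[xT xX] yX; rewrite /split_rel fT // andbN orbF.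
  have -> : x != v by apply: contraNneq xX => ->.
  have -> : y != v by apply: contraNneq yX => ->.
  by rewrite /= keep // !inE ?negb_and ?xX ?xT ?yX ?orbT.
(* The only neighbour that [w] can gain in this deletion is [f w]. *)
- move=> w wT; rewrite cX; apply: (@leq_trans #|f w |: (nbrs e' w :\: nbrs e w)|).
    apply: subset_leq_card; apply/subsetP=> u; rewrite !inE /split_rel.
    move=> /andP[-> /and3P[_ _ /orP[->|/andP[/eqP-> _]]]]; rewrite ?eqxx ?orbT //.
  by rewrite cardsU1 leq_add ?leq_b1 ?new.
- split=> [w wT nwz|].
    rewrite -degs //; have := deg w (nTv w wT).
    suff -> : e' v w = (f w != w) by apply: addIn.
    apply/idP/idP=> [evw|/fe[/Yv]//]; apply/fY/Y0Y => //.
    by rewrite !inE wT.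
  (* Only [z] can be adjacent to [v] yet unmatched, and it then loses one neighbour. *)
  have := deg z (nTv z zT); rewrite cX; move: degz.
  case: (e' v z); case: (f z != z); clear; lia.
Qed.

(** If every inclusion before [n] were strict, [A n] would have at least [n] elements. *)
Lemma chain_stabilizes (T : finType) (A : nat -> {set T}) n :
  (forall i, A i \subset A i.+1) -> #|A n| < n -> exists2 i, i < n & A i.+1 = A i.
Proof.
move=> mono ltn; apply: contrapT => nex; move: ltn; apply/negP; rewrite -leqNgt.
suff: forall i, i <= n -> i <= #|A i| by apply.
elim=> // i IH ltin; apply: leq_ltn_trans (IH (ltnW ltin)) _.
apply: proper_card; rewrite properEneq mono andbT; apply/eqP=> eqA.
by apply: nex; exists i.
Qed.

Lemma card_bigcup_le (I T : finType) (A : {set I}) (F : I -> {set T}) m :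
  {in A, forall i, #|F i| <= m} -> #|\bigcup_(i in A) F i| <= #|A| * m.
Proof.
move=> Fm; rewrite -sum_nat_const; apply: (@leq_trans (\sum_(i in A) #|F i|)).
  elim/big_ind2: _ => [|U m1 W m2 h1 h2|//]; first by rewrite cards0.
  by rewrite (leq_trans (leq_card_setU _ _)) // leq_add.
by apply: leq_sum.
Qed.

(* The vertex [z] may fall short of the required degree; its near-twins are deleted
   first. *)
Lemma almost_min_degree_immerses (V : finType) (e : rel V) t z :
  1 < t -> symmetric e -> irreflexive e -> 20 * t ^ 3 <= #|nbrs e z| + t ->
  (forall x, x != z -> nbrs e x != set0 -> 20 * t ^ 3 <= #|nbrs e x|) ->
  immerses t e.
Proof.
move=> t1; have [n] := ubnP #|[set x | nbrs e x != set0]|.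
elim: n e z => // n IH e z ltn es ei degz degs; apply: contrapT => nimm.
set N := nbrs e z in degz.
have [t2 t3] : 4 * t <= 2 * t ^ 2 /\ 2 * t ^ 2 <= t ^ 3.
  by rewrite !expnS expn0 muln1; split; [nia|rewrite leq_mul2r t1 orbT].
(* These are the near-twins of [z] at scale [i]. *)
pose A i := [set w | #|N :\: nbrs e w| <= 7 * t * i].
have AS i : A i \subset A i.+1.
  by apply/subsetP=> w; rewrite !inE mulnS => h; apply: leq_trans h (leq_addl _ _).
(* Two near-twins each miss at most [7 * t ^ 2] vertices of [N], hence share more than [3 * t]; [t]
   of them would carry an immersion. *)
have cA i : i <= t -> #|A i| < t.
  move=> leit; rewrite ltnNge; apply: contra_notN nimm => cA.
  apply: (common_nbrs_immerses (ltnW t1) es cA) => x y; rewrite !inE => xA yA _.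
  have cover : N \subset nbrs e x :&: nbrs e y :|: (N :\: nbrs e x :|: N :\: nbrs e y).
    apply/subsetP=> u uN; rewrite !in_setU in_setI !in_setD uN !andbT.
    by case: (u \in nbrs e x); case: (u \in nbrs e y).
  have h1 := leq_trans (subset_leq_card cover) (leq_card_setU _ _).
  have h2 := (leq_card_setU (N :\: nbrs e x) (N :\: nbrs e y)).1.
  have h3 : 7 * t * i <= 7 * t ^ 2 by rewrite -mulnA leq_mul2l expnS expn1 leq_mul2l leit orbT.
  move: degz t2 t3 h1 h2 h3 xA yA; clear; lia.
have [j ltjt Aj] := chain_stabilizes AS (cA t (leqnn t)).
set T := A j in Aj; have cT : #|T| < t by apply: cA; apply: ltnW.
have zT : z \in T by rewrite inE setDv cards0.
(* Together the vertices of [T] miss at most [7 * t ^ 3] vertices of [N], so some [u] outside [T] is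
   adjacent to all of them. It absorbs the parity defects. *)
have [u] : exists u, u \in N :\: (T :|: \bigcup_(w in T) (N :\: nbrs e w)).
  apply/card_gt0P; rewrite cardsD subn_gt0.
  apply: leq_ltn_trans (subset_leq_card (subsetIr _ _)) _.
  apply: leq_ltn_trans (leq_card_setU _ _) _.
  have h1 : #|\bigcup_(w in T) (N :\: nbrs e w)| <= #|T| * (7 * t * j).
    by apply: card_bigcup_le => w; rewrite inE.
  have h2 : #|T| * (7 * t * j) <= 7 * t ^ 3.
    rewrite mulnA mulnCA -mulnA leq_mul2l /= !expnS expn0 muln1 mulnA.
    by rewrite leq_mul ?leq_mul // ltnW.
  move: degz t2 t3 cT h1 h2; clear; lia.
case/setDP=> uN; rewrite in_setU negb_or => /andP[uT uB].
have ezu : e z u by move: uN; rewrite inE.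
have eT v : v \in T -> e v u.
  move=> vT; apply/negPn/negP=> nev; case/negP: uB; apply/bigcupP; exists v => //.
  by rewrite !inE nev.
(* Here [v] misses at most [7 * t * j] vertices of [N], while [w], being outside [A j.+1] too,
   misses more than [7 * t * j.+1]. *)
have gap v w : v \in T -> w \notin T -> 7 * t <= #|nbrs e v :\: nbrs e w|.
  rewrite -Aj [w \in _]inE -ltnNge => + wT; rewrite Aj inE => vT.
  have cover : N :\: nbrs e w \subset (nbrs e v :\: nbrs e w) :|: (N :\: nbrs e v).
    apply/subsetP=> x; rewrite in_setU !in_setD => /andP[-> ->].
    by case: (x \in nbrs e v).
  have h := leq_trans (subset_leq_card cover) (leq_card_setU _ _).
  move: h vT wT; rewrite mulnS; clear; lia.
have [e' [[es' ei' nimm'] isol _ _ [deg' degu]]] :=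
  cluster_deletion t1 es ei nimm (ltnW cT) uT eT gap (subxx T).
have nonisol x : nbrs e' x != set0 -> x \notin T.
  apply: contraNN => xT; apply/eqP/setP=> y; rewrite !inE.
  by apply: negbTE; apply: isol.
have nzu : u != z by apply: contraNneq uT => ->.
have u_nonisol : nbrs e u != set0 by apply/set0Pn; exists z; rewrite inE es.
(* Now [z] is isolated, and [u], having lost fewer than [t] neighbours, takes over its role. *)
apply: nimm'; apply: (IH e' u) => //.
- move: ltn; rewrite ltnS; apply: leq_trans; apply: proper_card; apply/properP; split.
    apply/subsetP=> x; rewrite !inE => nx; have [->//|nxu] := eqVneq x u.
    by rewrite -card_gt0 -deg' ?nonisol // card_gt0.
  exists z; first by rewrite inE; apply/set0Pn; exists u.
  by rewrite inE; apply: contraL zT => /nonisol.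
- have := degs u nzu u_nonisol; move: degu cT; clear; lia.
- move=> x nxu nx; have xT := nonisol x nx; rewrite deg' //; apply: degs.
    by apply: contraNneq xT => ->.
  by rewrite -card_gt0 -deg' // card_gt0.
Qed.

Definition induced (V : finType) (e : rel V) (W : {set V}) : rel V :=
  fun x y => [&& x \in W, y \in W & e x y].

Section Induced.
Variables (V : finType) (e : rel V) (W : {set V}).

Lemma induced_sym : symmetric e -> symmetric (induced e W).
Proof. by move=> es x y; rewrite /induced es andbCA. Qed.

Lemma induced_irrefl : irreflexive e -> irreflexive (induced e W).
Proof. by move=> ei x; rewrite /induced ei !andbF. Qed.

Lemma induced_immerses t : immerses t (induced e W) -> immerses t e.
Proof. by apply: immerses_sub => x y /and3P[]. Qed.

Lemma nbrs_induced x : nbrs (induced e W) x = if x \in W then W :&: nbrs e x else set0.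
Proof. by apply/setP=> y; case: ifP => xW; rewrite !inE /induced xW. Qed.

End Induced.

Lemma polynomial_degree (V : finType) (e : rel V) t (W : {set V}) :
  1 < t -> symmetric e -> irreflexive e -> ~ immerses t e -> W != set0 ->
  exists2 v, v \in W & #|W :&: nbrs e v| < 20 * t ^ 3.
Proof.
move=> t1 es ei nimm /set0Pn[z zW]; apply/exists_inP; apply: contraPT nimm.
rewrite negb_exists_in => /forall_inP hW; apply; apply: (@induced_immerses _ _ W).
apply: (almost_min_degree_immerses (z := z) t1).
- exact: induced_sym.
- exact: induced_irrefl.
- rewrite nbrs_induced zW; have := hW z zW; rewrite -leqNgt => h.
  exact: leq_trans h (leq_addr _ _).
- by move=> x _; rewrite nbrs_induced; case: ifP => [xW _|]; rewrite ?eqxx // leqNgt hW.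
Qed.

(** * A logarithmic average degree forces an immersion *)

(** A maximal matching of non-edges among the neighbours of [v] leaves a clique unmatched, hence
    fewer than [t] vertices. Besides [v], only these lose degree, one each. *)
Lemma delete_vertex (V : finType) (e : rel V) t v :
  1 < t -> symmetric e -> irreflexive e -> ~ immerses t e ->
  exists e' : rel V, [/\ [/\ symmetric e', irreflexive e' & ~ immerses t e'],
    forall x y, e' x y -> [/\ x != v, nbrs e x != set0 & nbrs e y != set0] &
    \sum_x #|nbrs e x| <= \sum_x #|nbrs e' x| + #|nbrs e v| + t].
Proof.
move=> t1 es ei nimm.
have [f [[fK fe] clf _]] := comatching_maximal (nbrs e v) es.
have un_lt : #|unmatched (nbrs e v) f| < t.
  rewrite ltnNge; apply: contra_notN nimm => un; exact: (clique_immerses (ltnW t1) es un clf).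
have fe' y : f y != y -> e v y && ~~ e y (f y) by case/fe; rewrite inE => -> ->.
have nfv : f v = v by apply/eqP/negPn/negP => /fe'; rewrite ei.
exists (split_rel e v f); split.
- split; [exact: split_sym|exact: split_irrefl|].
  by move=> /(split_immerses t1 es fK fe').
- move=> x y /and3P[nxv nyv /orP[exy|/andP[/eqP <- nfx]]]; split=> //; apply/set0Pn.
  + by exists y; rewrite inE.
  + by exists x; rewrite inE es.
  + by exists v; rewrite inE es; have /fe'/andP[-> _] : f x != x by rewrite eq_sym.
  + by exists v; rewrite inE es; have /fe'/andP[-> _] : f (f x) != f x by rewrite fK.
- have key x : x != v ->
      #|nbrs e x| + (f x != x) = #|nbrs (split_rel e v f) x| + e v x.
    by move=> nxv; rewrite card_nbrs_split.
  have sum_v (F : V -> nat) : \sum_x F x = F v + \sum_(x | x != v) F x.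
    by rewrite (bigD1 v).
  have eqsum : \sum_(x | x != v) #|nbrs e x| + \sum_(x | x != v) (f x != x) =
     \sum_(x | x != v) #|nbrs (split_rel e v f) x| + \sum_(x | x != v) (e v x).
    by rewrite -!big_split; apply: eq_bigr => x /key.
  have se : \sum_(x | x != v) e v x = #|nbrs e v|.
    rewrite -sum1_card [RHS]big_mkcond sum_v inE ei add0n.
    by apply: eq_bigr => x _; rewrite inE; case: (e v x).
  have sf : \sum_(x | x != v) (f x != x) + #|unmatched (nbrs e v) f| = #|nbrs e v|.
    rewrite -se -sum1_card [X in _ + X]big_mkcond [X in _ + X]sum_v !inE ei add0n.
    rewrite -big_split; apply: eq_bigr => x _; rewrite !inE.
    by have [fx|/fe'/andP[->]] := eqVneq (f x) x; case: (e v x).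
  rewrite sum_v [X in _ <= X + _ + _]sum_v; move: eqsum se sf un_lt; clear; lia.
Qed.

Section AverageDegree.
Local Open Scope ring_scope.

Definition harmonic (m : nat) : rat := \sum_(1 <= i < m) i%:R^-1.

Lemma harmonicS m : (0 < m)%N -> harmonic m.+1 = harmonic m + m%:R^-1.
Proof. by move=> m0; rewrite /harmonic big_nat_recr. Qed.

Lemma harmonic_ge0 m : 0 <= harmonic m.
Proof. by apply: sumr_ge0 => i _; rewrite invr_ge0 ler0n. Qed.

(** Each dyadic block from [2 ^ k] to [2 ^ k.+1 - 1] contributes at most 1. *)
Lemma harmonic_le m k : (m <= 2 ^ k)%N -> harmonic m <= k%:R.
Proof.
move=> mk; apply: (@le_trans _ _ (harmonic (2 ^ k))).
  have [m0|m0] := posnP m; first by rewrite m0 /harmonic big_geq // harmonic_ge0.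
  rewrite /harmonic (big_cat_nat m0 mk) /= lerDl.
  by apply: sumr_ge0 => i _; rewrite invr_ge0 ler0n.
elim: {m mk} k => [|k IH]; first by rewrite /harmonic big_geq.
rewrite /harmonic (@big_cat_nat _ _ _ (2 ^ k)%N) ?expn_gt0 ?leq_exp2l //= -natr1.
apply: lerD => //; apply: (@le_trans _ _ (\sum_(2 ^ k <= i < 2 ^ k.+1) (2 ^ k)%N%:R^-1)).
  apply: ler_sum_nat => i /andP[ki _]; rewrite lef_pV2 ?posrE ?ltr0n ?ler_nat //.
    by rewrite (leq_trans _ ki) ?expn_gt0.
  by rewrite expn_gt0.
rewrite sumr_const_nat expnS mul2n -addnn addnK -(mulr_natr (2 ^ k)%N%:R^-1) mulVf //.
by rewrite pnatr_eq0 -lt0n expn_gt0.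
Qed.

(** With [m] vertices and degree sum [s], the minimum degree is at most [s / m]. Deletion leaves a
    sum of at least [s - s / m - t], so the average drops by at most [t / (m - 1)], the last term of
    [t * harmonic m]. *)
Lemma average_degree_immerses (V : finType) (e : rel V) t (W : {set V}) :
  (1 < t)%N -> symmetric e -> irreflexive e -> W != set0 ->
  (forall x, nbrs e x != set0 -> x \in W) ->
  #|W|%:R * (1 + t%:R * harmonic #|W|) <= (\sum_x #|nbrs e x|)%N%:R -> immerses t e.
Proof.
move=> t1; have [m] := ubnP #|W|; elim: m e W => // m IH e W ltm es ei W0 supp le_sum.
apply: contrapT => nimm.
have sumW : (\sum_x #|nbrs e x|)%N = (\sum_(x in W) #|nbrs e x|)%N.
  rewrite [RHS]big_mkcond; apply: eq_bigr => x _; case: ifP => // xW.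
  by apply/eqP; rewrite cards_eq0; apply: contraFT xW => /supp.
have [w0 w0W] := set0Pn _ W0.
case: (arg_minnP (fun x => #|nbrs e x|) w0W) => v /= vW vmin; have {}vW : v \in W := vW.
have cW := cardsD1 v W; rewrite vW /= in cW.
have min_sum : (#|W| * #|nbrs e v| <= \sum_x #|nbrs e x|)%N.
  by rewrite sumW -sum_nat_const; apply: leq_sum.
(* A single vertex has degree sum 0, contradicting the lower bound 1. *)
have [W1|W'0] := eqVneq (W :\ v) set0.
  rewrite cW W1 cards0 in le_sum.
  move: le_sum; rewrite sumW (big1 _ _ _ _) ?mul1r => [|x xW]; last first.
    apply/eqP; rewrite cards_eq0; apply/eqP/setP=> y; rewrite !inE.
    have eqv u : u \in W -> u = v.
      by move=> uW; apply/eqP/negPn/negP=> nuv; have := in_set0 u; rewrite -W1 !inE nuv uW.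
    apply/negP=> exy; have yW : y \in W by apply: supp; apply/set0Pn; exists x; rewrite inE es.
    by rewrite (eqv x xW) (eqv y yW) ei in exy.
  by rewrite /harmonic big_geq // mulr0 addr0 ler10.
have [e' [[es' ei' nimm'] supp' sum']] := delete_vertex v t1 es ei nimm.
apply: nimm'; apply: (IH e' (W :\ v)) => //; first by move: ltm; rewrite cW add1n ltnS.
  move=> x /set0Pn[y]; rewrite !inE => /supp'[-> nx _]; exact: supp.
have c0 : (0 < #|W :\ v|)%N by rewrite card_gt0.
move: le_sum min_sum sum'; rewrite cW add1n harmonicS //.
set s := (\sum_x #|nbrs e x|)%N; set s' := (\sum_x #|nbrs e' x|)%N.
set k := #|W :\ v| in c0 *; set d := #|nbrs e v|; set h := harmonic k.
move=> h1; rewrite -(ler_nat rat) natrM -(ler_nat rat) !natrD => h2 h3.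
have k0 : 0 < k%:R :> rat by rewrite ltr0n.
have k1 : 0 < k.+1%:R :> rat by rewrite ltr0n.
(* Multiplying by both vertex counts [k] and [k.+1] clears the denominators and leaves inequalities
   linear in the products. *)
have hk : k%:R * (k.+1%:R * (1 + t%:R * (h + k%:R^-1))) =
    k.+1%:R * (k%:R * (1 + t%:R * h)) + k.+1%:R * t%:R :> rat.
  by field; rewrite pnatr_eq0 -lt0n.
have h1' := ler_wpM2l (ltW k0) h1; rewrite hk in h1'.
have h3' := ler_wpM2l (ltW k1) h3; rewrite !mulrDr in h3'.
rewrite -(ler_pM2l k1); apply: le_trans (_ : k%:R * s%:R - k.+1%:R * t%:R <= _).
  by rewrite lerBrDr.
have : k.+1%:R * s%:R = k%:R * s%:R + s%:R :> rat by rewrite -natr1 mulrDl mul1r.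
move: h2 h3'; clear; lra.
Qed.

Lemma logarithmic_degree (V : finType) (e : rel V) t k (W : {set V}) :
  (1 < t)%N -> symmetric e -> irreflexive e -> ~ immerses t e -> W != set0 ->
  (#|W| <= 2 ^ k)%N -> exists2 v, v \in W & (#|W :&: nbrs e v| <= t * k)%N.
Proof.
move=> t1 es ei nimm W0 cW; apply/exists_inP; apply: contraPT nimm.
rewrite negb_exists_in => /forall_inP hW; apply; apply: (@induced_immerses _ _ W).
apply: (@average_degree_immerses _ _ t W) => //; [exact: induced_sym|exact: induced_irrefl| |].
  by move=> x; rewrite nbrs_induced; case: ifP; rewrite ?eqxx.
apply: (@le_trans _ _ (#|W| * (t * k).+1)%N%:R).
  rewrite natrM ler_wpM2l ?ler0n // -addn1 natrD addrC lerD2r natrM.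
  by rewrite ler_wpM2l ?ler0n ?harmonic_le.
rewrite ler_nat -sum_nat_const [X in (X <= _)%N]big_mkcond; apply: leq_sum => x _.
by rewrite nbrs_induced; case: ifP => // xW; rewrite ltnNge hW.
Qed.

End AverageDegree.

(** * Counting cliques *)

Section CliqueCounting.
Variables (V : finType) (e : rel V).
Implicit Types W K : {set V}.

Definition clique_rel K := [forall x in K, forall y in K, (x != y) ==> e x y].

Definition cliques_in W := [set K : {set V} | (K \subset W) && clique_rel K].

Lemma clique_relP K :
  reflect {in K &, forall x y, x != y -> e x y} (clique_rel K).
Proof.
apply: (iffP forall_inP) => [h x y xK yK nxy|h x xK].
  by have /forall_inP/(_ y yK)/implyP := h x xK; apply.
by apply/forall_inP=> y yK; apply/implyP; apply: h.
Qed.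

Lemma card_cliques_in W : #|cliques_in W| <= 2 ^ #|W|.
Proof.
rewrite -card_powerset; apply: subset_leq_card; apply/subsetP=> K.
by rewrite !inE => /andP[].
Qed.

(** The cliques containing [v] are recovered from cliques among its neighbours by adding [v]. *)
Lemma card_cliques_recur W v : v \in W ->
  #|cliques_in W| <= #|cliques_in (W :\ v)| + #|cliques_in (W :&: nbrs e v)|.
Proof.
move=> vW; set A := cliques_in (W :\ v); set B := cliques_in (W :&: nbrs e v).
apply: (@leq_trans (#|A| + #|(fun K => v |: K) @: B|)); last first.
  by rewrite leq_add2l leq_imset_card.
apply: leq_trans (leq_card_setU _ _); apply: subset_leq_card; apply/subsetP=> K.
rewrite [in X in X -> _]inE => /andP[KW clK]; rewrite in_setU.
have [vK|vK] := boolP (v \in K); last by rewrite inE subsetD1 KW vK clK.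
apply/orP; right; apply/imsetP; exists (K :\ v); last by rewrite setD1K.
move/clique_relP: clK => clK; rewrite inE; apply/andP; split.
  apply/subsetP=> x /setD1P[nxv xK]; rewrite !inE (subsetP KW) //=.
  by apply: clK; rewrite // eq_sym.
by apply/clique_relP => x y /setD1P[_ xK] /setD1P[_ yK]; apply: clK.
Qed.

(** Each removal of a vertex of small degree accounts for at most [F] cliques; the 1 is the empty
    clique. *)
Lemma card_cliques_degenerate d F W :
  (forall W' : {set V}, W' \subset W -> W' != set0 -> exists2 v, v \in W' & #|W' :&: nbrs e v| <= d) ->
  (forall Z : {set V}, #|Z| <= d -> #|cliques_in Z| <= F) ->
  #|cliques_in W| <= 1 + #|W| * F.
Proof.
move=> degen small; have [n] := ubnP #|W|; elim: n W degen => // n IH W degen ltn.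
have [->|W0] := eqVneq W set0.
  by rewrite cards0 mul0n addn0 (leq_trans (card_cliques_in _)) // cards0.
have [v vW dv] := degen W (subxx W) W0.
apply: leq_trans (card_cliques_recur vW) _.
have cW := cardsD1 v W; rewrite vW /= in cW.
have h1 : #|cliques_in (W :\ v)| <= 1 + #|W :\ v| * F.
  apply: IH => [W' sub|]; last by rewrite cW in ltn.
  by apply: degen; apply: subset_trans sub (subD1set _ _).
have h2 := small _ dv; rewrite cW mulnDl mul1n; lia.
Qed.

Variable t : nat.
Hypotheses (t_gt1 : 1 < t) (e_sym : symmetric e) (e_irrefl : irreflexive e).
Hypothesis no_imm : ~ immerses t e.

Lemma card_cliques_dense k W x : x < 2 ^ k -> #|W| <= t + x ->
  #|cliques_in W| <= 2 ^ (t + 'C(k.+1, 2)).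
Proof.
have small W' E : #|W'| <= E -> #|cliques_in W'| <= 2 ^ E.
  by move=> h; apply: leq_trans (card_cliques_in _) _; rewrite leq_exp2l.
elim: k W x => [|k IH] W x.
  rewrite expn0 ltnS leqn0 => /eqP-> cW; apply: small.
  by rewrite (leq_trans cW) // leq_add2l.
move=> xk cW.
(* Unrolling the recursion in [x] gives [x.+1] terms, each bounded by the case [k]. As [x.+1] is at
   most [2 ^ k.+1], this raises the exponent from ['C(k.+1, 2)] to ['C(k.+2, 2)]. *)
suff: #|cliques_in W| <= x.+1 * 2 ^ (t + 'C(k.+1, 2)).
  move/leq_trans; apply.
  have -> : 'C(k.+2, 2) = k.+1 + 'C(k.+1, 2) by rewrite binS bin1 addnC.
  rewrite addnCA [2 ^ (k.+1 + _)]expnD.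
  by rewrite leq_mul2r xk orbT.
elim: x W xk cW => [|x IHx] W xk cW.
  rewrite mul1n; apply: small; rewrite (leq_trans cW) //; lia.
rewrite mulSn addnC; have [le|gt] := leqP #|W| (t + x).
  by apply: leq_trans (IHx W (ltnW xk) le) (leq_addr _ _).
have eqW : #|W| = t + x.+1 by lia.
have [v vW dv] := dense_immerses (ltnW t_gt1) e_sym e_irrefl eqW (ltn0Sn x) no_imm.
apply: leq_trans (card_cliques_recur vW) _; apply: leq_add.
  by apply: IHx; [exact: ltnW|have := cardsD1 v W; rewrite vW eqW /=; lia].
apply: IH dv; move: xk; rewrite expnS; lia.
Qed.

(** Degeneracy is applied twice: later neighbourhoods in [V] have at most [2 ^ m] vertices, and
    later neighbourhoods inside those at most [t * m], where the dense bound holds with excess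
    [x = t * m]. *)
Lemma card_cliques_le k m : 20 * t ^ 3 <= 2 ^ m -> t * m < 2 ^ k ->
  #|cliques_in [set: V]| <= 1 + #|V| * 2 ^ (m + (t + 'C(k.+1, 2))).+1.
Proof.
move=> tm mk; set E := t + _.
rewrite -cardsT; apply: (@card_cliques_degenerate (20 * t ^ 3).-1).
  move=> W' _ W0; have [v vW dv] := polynomial_degree t_gt1 e_sym e_irrefl no_imm W0.
  by exists v; rewrite // -ltnS (ltn_predK dv).
move=> Z cZ; apply: (@leq_trans (1 + 2 ^ m * 2 ^ E)); last first.
  by rewrite -expnD expnS; have := expn_gt0 2 (m + E); lia.
have cZm : #|Z| <= 2 ^ m by apply: leq_trans cZ _; apply: leq_trans (leq_pred _) _.
apply: (@leq_trans (1 + #|Z| * 2 ^ E)); last by rewrite leq_add2l leq_mul2r cZm orbT.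
apply: (@card_cliques_degenerate (t * m)).
  move=> W' WZ W0; apply: (logarithmic_degree t_gt1 e_sym e_irrefl no_imm W0).
  exact: leq_trans (subset_leq_card WZ) cZm.
by move=> Y cY; apply: card_cliques_dense mk _; rewrite (leq_trans cY) // leq_addl.
Qed.

End CliqueCounting.

(** With [q = l %/ 8] this bounds [3 * l + 8] by [2 ^ q]. The start at 8 is the source of the
    threshold [64 <= l]. *)
Lemma exp_beats_linear q : 8 <= q -> 24 * q + 32 <= 2 ^ q.
Proof.
by elim: q => // q IH; rewrite leq_eqVlt => /predU1P[<- //|/IH]; rewrite expnS; lia.
Qed.

Lemma card_cliques_immersion (G : sgraph) t l : 64 <= l -> 2 ^ l <= t < 2 ^ l.+1 ->
  0 < #|G| -> ~ has_strong_immersion (complete t) G ->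
  #|cliques G| <= 2 ^ (t + l ^ 2) * #|G|.
Proof.
move=> l64 /andP[lt tl] G0 nimm.
have t1 : 1 < t by apply: leq_trans lt; rewrite -[2]expn1 leq_exp2l //; lia.
(* The slack [q] must exceed the logarithm of [3 * l + 8], yet stay small enough that half the
   square of [l + q] remains well below [l ^ 2]. *)
set q := l %/ 8; have q8 : 8 <= q by rewrite /q; lia.
have ql : l < 8 * q.+1 by rewrite /q; lia.
have lq : 8 * q <= l by rewrite /q; lia.
(* Here [20 <= 2 ^ 5] and [t < 2 ^ l.+1]. *)
have tm : 20 * t ^ 3 <= 2 ^ (3 * l + 8).
  have -> : 3 * l + 8 = 5 + l.+1 * 3 by lia.
  by rewrite expnD expnM leq_mul // leq_exp2r // ltnW.
have mk : t * (3 * l + 8) < 2 ^ (l.+1 + q).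
  apply: (@leq_ltn_trans (t * 2 ^ q)).
    by rewrite leq_mul2l; have := exp_beats_linear q8; lia.
  by rewrite expnD ltn_mul2r expn_gt0.
have cliquesE : cliques_in adj [set: G] = cliques G.
  by apply/setP=> K; rewrite !inE subsetT.
have := card_cliques_le t1 (@adj_sym G) (@adj_irrefl G)
  (fun h => nimm (immerses_strong h)) tm mk.
rewrite cliquesE => /leq_trans; apply; set E := 3 * l + 8 + _.
have El : E.+2 <= t + l ^ 2.
  rewrite /E bin2 /= expnS expn1.
  have : 2 * ((l.+1 + q).+1 * (l.+1 + q))./2 <= (l.+1 + q).+1 * (l.+1 + q) by lia.
  nia.
apply: (@leq_trans (#|G| * 2 ^ E.+2)); last by rewrite mulnC leq_mul2r leq_exp2l // El orbT.
by rewrite [2 ^ E.+2]expnS mulnCA; have := expn_gt0 2 E.+1; nia.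
Qed.

(** * The lower bound *)

Lemma path_incident_edge (V : finType) (e : rel V) x p z :
  symmetric e -> path e x p -> p != [::] -> z \in x :: p ->
  exists2 y, e z y & [set z; y] \in [seq [set xy.1; xy.2] | xy <- zip (x :: p) p].
Proof.
move=> es; elim: p x => [//|y p IH] x /= /andP[exy pth] _; rewrite inE => /predU1P[->|zp].
  by exists y; rewrite // mem_head.
have [p0|p0] := eqVneq p [::].
  move: zp; rewrite p0 inE => /eqP->; exists x; first by rewrite es.
  by rewrite setUC mem_head.
have [w ezw win] := IH y pth p0 zp; exists w => //.
by rewrite inE win orbT.
Qed.

(** The [t - 1] paths ending at a branch vertex use distinct edges there, hence reach distinct
    neighbours. *)
Lemma weak_immersion_degree (G : sgraph) t (m : weak_immersion (complete t) G) i :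
  t <= #|nbrs adj (branch m i)|.+1.
Proof.
have edgeE j : j != i -> [set i; j] \in edges (complete t).
  move=> nji; rewrite inE; apply/existsP; exists i; apply/existsP; exists j.
  by rewrite eqxx andbT /= /complete_rel eq_sym.
have [y yP] : {y : 'I_t -> G | forall j, j != i -> adj (branch m i) (y j) /\
    [set branch m i; y j] \in path_edges (route m [set i; j])}.
  apply: cid; suff /choice[y yP] : forall j, exists y, j != i -> adj (branch m i) y /\
      [set branch m i; y] \in path_edges (route m [set i; j]) by exists y.
  move=> j; have [_|nji] := eqVneq j i; first by exists (branch m i).
  have := route_path m (edgeE j nji); have := route_ends m (edgeE j nji).
  case: (route m _) => [//|x p]; rewrite /is_path /path_ends /path_edges /= imsetU1 imset_set1.
  move=> ends /andP[_ pth].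
  have iin : branch m i \in [set x; last x p] by rewrite ends set21.
  have jin : branch m j \in [set x; last x p] by rewrite ends set22.
  have p0 : p != [::].
    apply: contraNneq nji => p0; move: iin jin; rewrite p0 !inE !orbb => /eqP<-.
    by rewrite (inj_eq (@branch_inj _ _ m)).
  have [|y ey yin] := path_incident_edge (z := branch m i) (@adj_sym G) pth p0.
    by case/set2P: iin => ->; rewrite ?mem_head ?mem_last.
  by exists y => _; rewrite inE.
have yinj : {in [set~ i] &, injective y}.
  move=> j k; rewrite !in_setC1 => nji nki yjk; apply/eqP/negPn/negP => njk.
  have nE : [set i; j] != [set i; k].
    apply: contraNneq njk => eqE; have : j \in [set i; k] by rewrite -eqE set22.
    by rewrite !inE (negPf nji).
  have [_ h1] := yP j nji; have [_ h2] := yP k nki; rewrite -yjk in h2.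
  have /pred0P/(_ [set branch m i; y j]) := route_disjoint m (edgeE j nji) (edgeE k nki) nE.
  by rewrite /= h1 h2.
apply: (@leq_trans #|[set~ i]|.+1); first by rewrite cardsC1 card_ord leqSpred.
rewrite ltnS -(card_in_imset yinj); apply: subset_leq_card; apply/subsetP=> z.
by case/imsetP=> j; rewrite in_setC1 => /yP[ay _] ->; rewrite inE.
Qed.

Section HubGraph.
Variables (n s : nat).

(** For [s <= n] this is the complete graph on [s] vertices joined to an independent set. *)
Definition hub_rel : rel 'I_n := fun x y => (x != y) && ((x < s) || (y < s)).

Fact hub_sym : symmetric hub_rel.
Proof. by move=> x y; rewrite /hub_rel eq_sym orbC. Qed.

Fact hub_irrefl : irreflexive hub_rel.
Proof. by move=> x; rewrite /hub_rel eqxx. Qed.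

Definition hub_graph : sgraph := SGraph hub_sym hub_irrefl.

Definition hubs : {set hub_graph} := [set x : 'I_n | x < s].

Lemma card_hubs : s <= n -> #|hubs| = s.
Proof.
move=> sn; rewrite -[RHS](card_ord s) -cardsT -(card_imset _ (f := widen_ord sn)); last first.
  by move=> x y /(congr1 val) /= /val_inj.
congr #|pred_of_set _|; apply/setP=> x; rewrite inE; apply/idP/imsetP => [xs|[y _ ->]]; last exact: (ltn_ord y).
by exists (Ordinal xs) => //; apply: val_inj.
Qed.

(** A vertex that is not a hub has degree at most [s], too small for a branch vertex, and there are
    fewer than [t] hubs. *)
Lemma hub_graph_no_immersion t : s <= n -> s.+1 < t ->
  ~ has_strong_immersion (complete t) hub_graph.
Proof.
move=> sn st [m _].
have hub i : branch m i \in hubs.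
  apply/negPn/negP=> ni; have := weak_immersion_degree m i; apply/negP; rewrite -ltnNge.
  apply: leq_ltn_trans st; rewrite ltnS -(card_hubs sn); apply: subset_leq_card.
  apply/subsetP=> y; move: ni; rewrite !inE /= /hub_rel => /negPf->.
  by case/andP.
have : #|[set branch m i | i : 'I_t]| <= #|hubs|.
  by apply: subset_leq_card; apply/subsetP=> x /imsetP[i _ ->].
rewrite (card_imset _ (@branch_inj _ _ m)) (card_hubs sn) card_ord; lia.
Qed.

(** Any set of hubs together with one vertex outside is a clique, and determines both. *)
Lemma card_cliques_hub_graph : s <= n -> 2 ^ s * (n - s) <= #|cliques hub_graph|.
Proof.
move=> sn; rewrite -[in 2 ^ s](card_hubs sn) -card_powerset.
have <- : #|~: hubs| = n - s by rewrite cardsCs setCK card_ord (card_hubs sn).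
rewrite -cardsX -(@card_in_imset _ _ (fun Av : {set hub_graph} * hub_graph => Av.2 |: Av.1)).
  apply: subset_leq_card; apply/subsetP=> K /imsetP[[A v] /setXP[/= + _] ->].
  rewrite inE => /subsetP Ah; rewrite inE.
  have Ahub x : x \in A -> x < s by move/Ah; rewrite inE.
  apply/forall_inP=> x xin; apply/forall_inP=> y yin; apply/implyP=> nxy.
  rewrite /= /hub_rel nxy /=; move: xin yin; rewrite !inE.
  case/predU1P=> [xv|/Ahub->//]; case/predU1P=> [yv|/Ahub->]; rewrite ?orbT //.
  by rewrite xv yv eqxx in nxy.
have sub (A B : {set hub_graph}) v w : A \subset hubs -> w \notin hubs ->
    v |: A = w |: B -> A \subset B.
  move=> Ah wh eqU; apply/subsetP=> x xA.
  have : x \in w |: B by rewrite -eqU setU1r.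
  by case/setU1P=> // xw; rewrite -xw (subsetP Ah) in wh.
move=> [A v] [B w] /setXP[/=] + + /setXP[/=].
rewrite !powersetE !in_setC => Ah vh Bh wh eqU.
have eqA : A = B by apply/eqP; rewrite eqEsubset (sub A B v w) // (sub B A w v).
congr pair => //; have : v \in w |: B by rewrite -eqU setU11.
by case/setU1P=> // vB; rewrite (subsetP Bh) in vh.
Qed.

End HubGraph.

(** * Real exponents and the two bounds *)

Local Open Scope ring_scope.

Section Log2.
Variable R : realType.

Lemma powR_log2 (x : R) : 0 < x -> 2 `^ log2 x = x.
Proof.
move=> x0; rewrite /powR pnatr_eq0 /= /log2 divfK ?lnK ?posrE //.
by rewrite gt_eqF // ln_gt0 // ltr1n.
Qed.

Lemma log2_ge (l t : nat) : (2 ^ l <= t)%N -> l%:R <= log2 (t%:R : R).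
Proof.
move=> lt; have t0 : (0 < t)%N by apply: leq_trans lt; rewrite expn_gt0.
have ln2 : 0 < ln (2 : R) by rewrite ln_gt0 // ltr1n.
rewrite /log2 ler_pdivlMr // mulr_natl -lnXn // ler_ln ?posrE ?exprn_gt0 ?ltr0n //.
by rewrite -natrX ler_nat.
Qed.

End Log2.

Theorem theorem1p1 (R : realType) :
  exists t0 : nat,
    (forall t n : nat, (t0 <= t)%N -> (1 <= n)%N ->
       forall G : sgraph, #|G| = n ->
         ~ has_strong_immersion (complete t) G ->
         #|cliques G|%:R <= 2 `^ (t%:R + log2 (t%:R : R) ^+ 2) * n%:R) /\
    (exists2 A : R, 0 < A &
       forall t n : nat, (t0 <= t)%N -> (t <= n)%N ->
         exists G : sgraph,
           [/\ #|G| = n,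
               ~ has_strong_immersion (complete t) G &
               2 `^ (- (A * log2 (t%:R : R) ^+ 2))
                 * 2 `^ (t%:R + log2 (t%:R : R) ^+ 2) * n%:R
               <= #|cliques G|%:R]).
Proof.
(* The threshold is known only through an equation, so that it is not expanded as a unary number. *)
have [N NE] : exists N, N = (2 ^ 64)%N by exists (2 ^ 64)%N.
have N0 : (2 ^ 2 <= N)%N by rewrite NE leq_exp2l.
exists N; split=> [t n tN n1 G cG nimm|].
  have t0 : (0 < t)%N by apply: leq_trans tN; apply: leq_trans N0.
  set l := trunc_log 2 t.
  have l64 : (64 <= l)%N by move: tN; rewrite NE; apply: trunc_log_max.
  have tl : (2 ^ l <= t < 2 ^ l.+1)%N by rewrite trunc_logP // trunc_log_ltn.
  have G0 : (0 < #|G|)%N by rewrite cG.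
  have := card_cliques_immersion l64 tl G0 nimm; rewrite cG -(ler_nat R) natrM.
  move/le_trans; apply; rewrite ler_wpM2r ?ler0n // natrX -[2 ^+ (t + _)]powR_mulrn ?ler0n //.
  apply: ler_powR; first by rewrite ler1n.
  have [tl1 _] := andP tl; have lL := log2_ge R tl1.
  by rewrite natrD lerD2l natrX lerXn2r ?nnegrE ?ler0n // (le_trans _ lL).
(* With [A = 2] the target is [2 ^ (t - L ^ 2) * n], against [2 ^ (t - 2) * (n - t + 2)] cliques. *)
exists 2 => // t n tN tn.
have t2 : (2 ^ 2 <= t)%N := leq_trans N0 tN.
move=> {N NE N0 tN}.
have t0 : 0 < t%:R :> R by rewrite ltr0n (leq_trans _ t2).
set L := log2 _; have L2 : 2 <= L := log2_ge R t2.
have sn : (t - 2 <= n)%N by rewrite (leq_trans (leq_subr _ _)).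
exists (hub_graph n (t - 2)); split.
- by rewrite card_ord.
- by apply: hub_graph_no_immersion => //; lia.
have := card_cliques_hub_graph sn; rewrite -(ler_nat R) natrM natrX => /(le_trans _); apply.
(* The left side is [2 ^ (L + 1)], and [L + 1 <= L ^ 2] as [2 <= L]. *)
have tL : t%:R * 2 <= 2 `^ (L ^+ 2) :> R.
  rewrite -[X in X * 2](powR_log2 t0) -{2}[2]powRr1 // -powRD ?pnatr_eq0 ?implybT //.
  by apply: ler_powR; [rewrite ler1n|rewrite -/L; nra].
rewrite -powRD ?pnatr_eq0 ?implybT //.
have -> : - (2 * L ^+ 2) + (t%:R + L ^+ 2) = t%:R - L ^+ 2 by ring.
rewrite powRB ?pnatr_eq0 ?implybT // powR_mulrn ?ler0n //.
have -> : 2 ^+ t = 2 ^+ (t - 2) * 4 :> R.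
  by rewrite -[in LHS](@subnK 2 t) 1?exprD //; [ring|lia].
have p0 : 0 < 2 ^+ (t - 2) :> R by rewrite exprn_gt0.
rewrite -!mulrA ler_pM2l //.
set P := 2 `^ _ in tL *; have P0 : 0 < P by rewrite powR_gt0.
rewrite mulrCA ler_pdivrMl //; set m := (n - (t - 2))%N.
(* Equality holds at [n = t], where [m = 2]; beyond that the right side grows faster. *)
have nm : 4 * n%:R <= t%:R * 2 * m%:R :> R.
  by rewrite -!natrM ler_nat /m; nia.
by apply: le_trans nm _; rewrite ler_wpM2r.
Qed.
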